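(* An s$\ell$-monoid $N$ is integral if and only if $N$ is isomorphic (as an s$\ell$-monoid) to the nuclear image $M_\gamma$ of some integral cancellative s$\ell$-monoid $M$ with respect to some nucleus $\gamma$ on $M$.
   Context: An s$\ell$-monoid is a structure $\langle M,\vee,\cdot,1\rangle$ where $\langle M,\vee\rangle$ is a join semilattice, $\langle M,\cdot,1\rangle$ is a monoid, and multiplication distributes over binary joins on both sides; it is ordered by its semilattice order. It is integral if $1$ is the top element, and cancellative if $ax\leq bx$ implies $a\leq b$ and $xa\leq xb$ implies $a\leq b$. A nucleus on $M$ is a monotone map $\gamma$ with $a\leq\gamma(a)=\gamma(\gamma(a))$ and $\gamma(a)\gamma(b)\leq\gamma(ab)$; the nuclear image $M_\gamma=\{a:\gamma(a)=a\}$ is an s$\ell$-monoid with inherited order, joins $\gamma(a\vee b)$, multiplication $\gamma(ab)$, unit $\gamma(1)$. *)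

(* Defs.v *)
From mathcomp Require Import ssreflect ssrfun.
From Stdlib Require Import ProofIrrelevance.

Set Implicit Arguments.
Unset Strict Implicit.
Unset Printing Implicit Defensive.

(* A plain record rather than a structure built on joinSemilatticeType and      *)
(* monoidType: those require a choiceType, and here the carrier is arbitrary.   *)
Record slmonoid := SLMonoid {
  slm_sort :> Type;
  slm_join : slm_sort -> slm_sort -> slm_sort;
  slm_mul : slm_sort -> slm_sort -> slm_sort;
  slm_one : slm_sort;
  slm_joinA : associative slm_join;
  slm_joinC : commutative slm_join;
  slm_joinxx : idempotent_op slm_join;
  slm_mulA : associative slm_mul;
  slm_mul1x : left_id slm_one slm_mul;
  slm_mulx1 : right_id slm_one slm_mul;
  slm_mulUl : left_distributive slm_mul slm_join;
  slm_mulUr : right_distributive slm_mul slm_join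
}.

Arguments slm_join {s} _ _ : rename.
Arguments slm_mul {s} _ _ : rename.
Arguments slm_one {s} : rename.

Declare Scope slm_scope.
Delimit Scope slm_scope with slm.
Local Open Scope slm_scope.

Notation "x ∨ y" := (slm_join x y) (at level 50, left associativity) : slm_scope.
Notation "x ⋅ y" := (slm_mul x y) (at level 40, left associativity) : slm_scope.

Definition slm_le (M : slmonoid) (x y : M) : Prop := x ∨ y = y.

Notation "x ≤ y" := (slm_le x y) (at level 70, no associativity) : slm_scope.

Definition integral (M : slmonoid) : Prop := forall x : M, x ≤ slm_one.

Definition cancellative (M : slmonoid) : Prop :=
  (forall a b x : M, a ⋅ x ≤ b ⋅ x -> a ≤ b) /\
  (forall a b x : M, x ⋅ a ≤ x ⋅ b -> a ≤ b).

Record nucleus (M : slmonoid) := Nucleus {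
  nucleus_fun :> M -> M;
  nucleus_mono : forall a b : M, a ≤ b -> nucleus_fun a ≤ nucleus_fun b;
  nucleus_ext : forall a : M, a ≤ nucleus_fun a;
  nucleus_idem : forall a : M, nucleus_fun (nucleus_fun a) = nucleus_fun a;
  nucleus_mul : forall a b : M,
    nucleus_fun a ⋅ nucleus_fun b ≤ nucleus_fun (a ⋅ b)
}.

Section OrderFacts.
Variable M : slmonoid.
Implicit Types x y z : M.

Lemma slm_lexx x : x ≤ x. Proof. exact: slm_joinxx. Qed.

Lemma slm_le_trans y x z : x ≤ y -> y ≤ z -> x ≤ z.
Proof. by rewrite /slm_le => xy yz; rewrite -yz slm_joinA xy. Qed.

Lemma slm_le_anti x y : x ≤ y -> y ≤ x -> x = y.
Proof. by rewrite /slm_le => xy yx; rewrite -xy slm_joinC yx. Qed.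

Lemma slm_leUl x y : x ≤ x ∨ y.
Proof. by rewrite /slm_le slm_joinA slm_joinxx. Qed.

Lemma slm_leUr x y : y ≤ x ∨ y.
Proof. by rewrite slm_joinC; exact: slm_leUl. Qed.

Lemma slm_leU x y z : x ≤ z -> y ≤ z -> x ∨ y ≤ z.
Proof. by rewrite /slm_le => xz yz; rewrite -slm_joinA yz. Qed.

Lemma slm_leM x x' y y' : x ≤ x' -> y ≤ y' -> x ⋅ y ≤ x' ⋅ y'.
Proof.
rewrite /slm_le => xx' yy'; apply: (@slm_le_trans (x' ⋅ y)).
  by rewrite /slm_le -slm_mulUl xx'.
by rewrite /slm_le -slm_mulUr yy'.
Qed.

End OrderFacts.

Section NuclearImage.
Variables (M : slmonoid) (g : nucleus M).
Implicit Types a b c : M.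

Lemma nucleus_joinl a b : g (g a ∨ b) = g (a ∨ b).
Proof.
apply: slm_le_anti.
  rewrite -[X in _ ≤ X]nucleus_idem; apply: nucleus_mono; apply: slm_leU.
    by apply: nucleus_mono; exact: slm_leUl.
  by apply: slm_le_trans (nucleus_ext g _); exact: slm_leUr.
apply: nucleus_mono; apply: slm_leU; last exact: slm_leUr.
exact: slm_le_trans (nucleus_ext g a) (slm_leUl _ _).
Qed.

Lemma nucleus_joinr a b : g (a ∨ g b) = g (a ∨ b).
Proof. by rewrite slm_joinC nucleus_joinl slm_joinC. Qed.

Lemma nucleus_mull a b : g (g a ⋅ b) = g (a ⋅ b).
Proof.
apply: slm_le_anti.
  rewrite -[X in _ ≤ X]nucleus_idem; apply: nucleus_mono.
  apply: slm_le_trans (nucleus_mul g _ _).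
  by apply: slm_leM (nucleus_ext g _); exact: slm_lexx.
by apply: nucleus_mono; apply: slm_leM (slm_lexx _); exact: nucleus_ext.
Qed.

Lemma nucleus_mulr a b : g (a ⋅ g b) = g (a ⋅ b).
Proof.
apply: slm_le_anti.
  rewrite -[X in _ ≤ X]nucleus_idem; apply: nucleus_mono.
  apply: slm_le_trans (nucleus_mul g _ _).
  by apply: slm_leM (slm_lexx _); exact: nucleus_ext.
by apply: nucleus_mono; apply: slm_leM (nucleus_ext g _); exact: slm_lexx.
Qed.

Definition nuclear_sort : Type := {a : M | g a = a}.

Definition nuclear_in a : nuclear_sort := exist _ (g a) (nucleus_idem g a).

Definition nuclear_join (x y : nuclear_sort) : nuclear_sort :=
  nuclear_in (sval x ∨ sval y).
Definition nuclear_mul (x y : nuclear_sort) : nuclear_sort :=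
  nuclear_in (sval x ⋅ sval y).
Definition nuclear_one : nuclear_sort := nuclear_in slm_one.

Lemma nuclear_inj (x y : nuclear_sort) : sval x = sval y -> x = y.
Proof.
case: x y => [a ga] [b gb] /= ab; case: _ / ab gb => gb.
by rewrite (proof_irrelevance _ ga gb).
Qed.

Lemma nuclear_joinA : associative nuclear_join.
Proof.
move=> x y z; apply: nuclear_inj => /=.
by rewrite nucleus_joinl nucleus_joinr slm_joinA.
Qed.

Lemma nuclear_joinC : commutative nuclear_join.
Proof. by move=> x y; apply: nuclear_inj; rewrite /= slm_joinC. Qed.

Lemma nuclear_joinxx : idempotent_op nuclear_join.
Proof. by case=> a ga; apply: nuclear_inj; rewrite /= slm_joinxx. Qed.

Lemma nuclear_mulA : associative nuclear_mul.
Proof.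
move=> x y z; apply: nuclear_inj => /=.
by rewrite nucleus_mull nucleus_mulr slm_mulA.
Qed.

Lemma nuclear_mul1x : left_id nuclear_one nuclear_mul.
Proof.
by case=> a ga; apply: nuclear_inj; rewrite /= nucleus_mull slm_mul1x.
Qed.

Lemma nuclear_mulx1 : right_id nuclear_one nuclear_mul.
Proof.
by case=> a ga; apply: nuclear_inj; rewrite /= nucleus_mulr slm_mulx1.
Qed.

Lemma nuclear_mulUl : left_distributive nuclear_mul nuclear_join.
Proof.
move=> x y z; apply: nuclear_inj => /=.
by rewrite nucleus_mull nucleus_joinl nucleus_joinr slm_mulUl.
Qed.

Lemma nuclear_mulUr : right_distributive nuclear_mul nuclear_join.
Proof.
move=> x y z; apply: nuclear_inj => /=.
by rewrite nucleus_mulr nucleus_joinl nucleus_joinr slm_mulUr.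
Qed.

Definition nuclear_image : slmonoid :=
  SLMonoid nuclear_joinA nuclear_joinC nuclear_joinxx nuclear_mulA
    nuclear_mul1x nuclear_mulx1 nuclear_mulUl nuclear_mulUr.

Lemma nuclear_leE (x y : nuclear_image) : x ≤ y <-> sval x ≤ sval y.
Proof.
split=> [xy | xy].
  have <- : sval (x ∨ y) = sval y by rewrite xy.
  exact: slm_le_trans (slm_leUl _ (sval y)) (nucleus_ext g _).
by apply: nuclear_inj; rewrite /= xy; exact: (svalP y).
Qed.

End NuclearImage.

Record slm_isomorphism (M N : slmonoid) (f : M -> N) : Prop := {
  slm_iso_bij : bijective f;
  slm_iso_join : {morph f : x y / x ∨ y};
  slm_iso_mul : {morph f : x y / x ⋅ y};
  slm_iso_one : f slm_one = slm_one
}.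

Definition slm_isomorphic (M N : slmonoid) : Prop :=
  exists f : M -> N, slm_isomorphism f.

(* Main.v *)
From mathcomp Require Import ssreflect ssrfun ssrbool ssrnat seq.
From mathcomp Require Import boolp classical_sets.
Require Import Defs.

Set Implicit Arguments.
Unset Strict Implicit.
Unset Printing Implicit Defensive.

Local Open Scope classical_set_scope.
Local Open Scope slm_scope.

(** The nonempty two-sided ideals of the free monoid of words over [N] form,
    under union and concatenation, an integral sl-monoid whose unit is the set
    of all words. It is cancellative: if [A C] is contained in [B C] and [c] is
    a shortest word of [C], then for every [w] in [A] we have [w c = b c'] with
    [b] in [B] and [c'] in [C] no shorter than [c], so [b] is a prefix of [w]
    and [w] is in [B].

    Let [N] be integral, and let [M] consist of the ideals [A] for which the
    products in [N] of the words of [A] have a least upper bound [f A] that is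
    preserved by multiplication on both sides. Then [M] is a sub-sl-monoid and
    [f] is a monoid morphism. The set [h n] of all words with product at most
    [n] is an ideal in [M], the map [h] is right adjoint to [f], and
    [f (h n) = n]; hence [h f] is a nucleus on [M] whose image is a copy of
    [N]. *)

Lemma nuclear_image_integral (M : slmonoid) (g : nucleus M) :
  integral M -> integral (nuclear_image g).
Proof.
move=> M_integral x; apply/nuclear_leE.
exact: slm_le_trans (M_integral _) (nucleus_ext g _).
Qed.

Lemma integral_isomorphic (M N : slmonoid) :
  slm_isomorphic M N -> integral N -> integral M.
Proof.
case=> f [bij_f fU _ f1] N_integral x; apply: (bij_inj bij_f).
by rewrite fU f1; exact: N_integral.
Qed.

Section SubSlmonoid.
Variables (M : slmonoid) (P : M -> Prop).
Hypothesis P_join : forall x y, P x -> P y -> P (x ∨ y).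
Hypothesis P_mul : forall x y, P x -> P y -> P (x ⋅ y).
Hypothesis P_one : P slm_one.
Implicit Types x y : {x : M | P x}.

Definition sub_join x y : {x : M | P x} :=
  exist P (sval x ∨ sval y) (P_join (svalP x) (svalP y)).
Definition sub_mul x y : {x : M | P x} :=
  exist P (sval x ⋅ sval y) (P_mul (svalP x) (svalP y)).
Definition sub_one : {x : M | P x} := exist P slm_one P_one.

Lemma sval_inj x y : sval x = sval y -> x = y.
Proof. by case: x y => [a Pa] [b Pb] /=; exact: eq_exist. Qed.

Lemma sub_joinA : associative sub_join.
Proof. by move=> x y z; apply: sval_inj; exact: slm_joinA. Qed.

Lemma sub_joinC : commutative sub_join.
Proof. by move=> x y; apply: sval_inj; exact: slm_joinC. Qed.

Lemma sub_joinxx : idempotent_op sub_join.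
Proof. by move=> x; apply: sval_inj; exact: slm_joinxx. Qed.

Lemma sub_mulA : associative sub_mul.
Proof. by move=> x y z; apply: sval_inj; exact: slm_mulA. Qed.

Lemma sub_mul1x : left_id sub_one sub_mul.
Proof. by move=> x; apply: sval_inj; exact: slm_mul1x. Qed.

Lemma sub_mulx1 : right_id sub_one sub_mul.
Proof. by move=> x; apply: sval_inj; exact: slm_mulx1. Qed.

Lemma sub_mulUl : left_distributive sub_mul sub_join.
Proof. by move=> x y z; apply: sval_inj; exact: slm_mulUl. Qed.

Lemma sub_mulUr : right_distributive sub_mul sub_join.
Proof. by move=> x y z; apply: sval_inj; exact: slm_mulUr. Qed.

Definition sub_slmonoid : slmonoid :=
  SLMonoid sub_joinA sub_joinC sub_joinxx sub_mulA
    sub_mul1x sub_mulx1 sub_mulUl sub_mulUr.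

Lemma sub_leE (x y : sub_slmonoid) : x ≤ y <-> sval x ≤ sval y.
Proof.
by split=> xy; [rewrite /slm_le -[in RHS]xy | exact: sval_inj].
Qed.

Lemma sub_integral : integral M -> integral sub_slmonoid.
Proof. by move=> M_integral x; apply/sub_leE; exact: M_integral. Qed.

Lemma sub_cancellative : cancellative M -> cancellative sub_slmonoid.
Proof.
move=> [cancelr cancell]; split=> a b x /sub_leE le_abx; apply/sub_leE.
  exact: cancelr le_abx.
exact: cancell le_abx.
Qed.

End SubSlmonoid.

Section AdjointNucleus.
Variables (M N : slmonoid) (f : M -> N) (h : N -> M).
Hypothesis f_mul : {morph f : x y / x ⋅ y}.
Hypothesis f_one : f slm_one = slm_one.
Hypothesis adjoint : forall a n, f a ≤ n <-> a ≤ h n.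
Hypothesis hK : cancel h f.

Lemma adjoint_unit a : a ≤ h (f a).
Proof. exact/adjoint/slm_lexx. Qed.

Lemma left_adjoint_mono a b : a ≤ b -> f a ≤ f b.
Proof. by move=> ab; apply/adjoint/(slm_le_trans ab)/adjoint_unit. Qed.

Lemma left_adjoint_join : {morph f : x y / x ∨ y}.
Proof.
move=> a b; apply: slm_le_anti.
  by apply/adjoint/slm_leU; apply/adjoint; [exact: slm_leUl | exact: slm_leUr].
apply: slm_leU; apply: left_adjoint_mono; first exact: slm_leUl.
exact: slm_leUr.
Qed.

Lemma adjoint_closure_mono a b : a ≤ b -> h (f a) ≤ h (f b).
Proof. by move=> ab; apply/adjoint; rewrite hK; exact: left_adjoint_mono. Qed.

Lemma adjoint_closure_idem a : h (f (h (f a))) = h (f a).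
Proof. by rewrite hK. Qed.

Lemma adjoint_closure_mul a b : h (f a) ⋅ h (f b) ≤ h (f (a ⋅ b)).
Proof. by apply/adjoint; rewrite f_mul !hK -f_mul; exact: slm_lexx. Qed.

Definition adjoint_nucleus : nucleus M :=
  @Nucleus M (fun a => h (f a)) adjoint_closure_mono adjoint_unit
    adjoint_closure_idem adjoint_closure_mul.

Lemma adjoint_nuclear_image : slm_isomorphic N (nuclear_image adjoint_nucleus).
Proof.
have f_sval_inj (x y : nuclear_image adjoint_nucleus) :
    f (sval x) = f (sval y) -> x = y.
  case: x y => [a ha] [b hb] /= fab; apply: (@nuclear_inj _ adjoint_nucleus).
  by rewrite /= -ha -hb /= fab.
exists (fun n => nuclear_in adjoint_nucleus (h n)); split.
- exists (fun x => f (sval x)) => [n | x] /=; first by rewrite !hK.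
  by apply: f_sval_inj; rewrite /= !hK.
- by move=> n m; apply: f_sval_inj; rewrite /= left_adjoint_join !hK.
- by move=> n m; apply: f_sval_inj; rewrite /= f_mul !hK.
- by apply: f_sval_inj; rewrite /= f_one !hK.
Qed.

End AdjointNucleus.

Lemma exists_argmin (T : Type) (f : T -> nat) (A : set T) :
  A !=set0 -> exists2 x, A x & forall y, A y -> f x <= f y.
Proof.
move=> [x0 Ax0].
have ex : exists n, `[< exists2 x, A x & f x = n >].
  by exists (f x0); apply/asboolP; exists x0.
case: (ex_minnP ex) => _ /asboolP[x Ax <-] minx; exists x => // y Ay.
by apply: minx; apply/asboolP; exists y.
Qed.

Section Words.
Variable T : Type.
Implicit Types (u v w : seq T) (A B C : set (seq T)).

Lemma eq_cat_prefix u v u' v' :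
  u ++ v = u' ++ v' -> size u' <= size u -> exists s, u = u' ++ s.
Proof.
move=> uv le_u'u; exists (drop (size u') u).
rewrite -{1}(cat_take_drop (size u') u) -(takel_cat v le_u'u) uv.
by rewrite take_size_cat.
Qed.

Lemma eq_cat_suffix u v u' v' :
  u ++ v = u' ++ v' -> size u <= size u' -> exists s, v = s ++ v'.
Proof.
move=> uv le_uu'; have [s def_u'] := eq_cat_prefix (esym uv) le_uu'.
exists s; rewrite -(drop_size_cat v (erefl (size u))) uv def_u' -catA.
exact: drop_size_cat.
Qed.

Definition left_ideal A := forall u v, A v -> A (u ++ v).
Definition right_ideal A := forall u v, A u -> A (u ++ v).

Definition lang_cat A B := [set u ++ v | u in A & v in B].

Lemma lang_catA : associative lang_cat.
Proof.
move=> A B C; apply/seteqP; split=> x /=.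
  move=> [u Au [_ [v Bv [w Cw <-]] <-]].
  by exists (u ++ v); [exists u => //; exists v | exists w; rewrite ?catA].
move=> [_ [u Au [v Bv <-]] [w Cw <-]].
by exists u => //; exists (v ++ w); [exists v => //; exists w | rewrite catA].
Qed.

Lemma lang_catUl : left_distributive lang_cat setU.
Proof.
move=> A B C; apply/seteqP; split=> w /=.
  by move=> [u [Au | Bu] [v Cv <-]]; [left | right]; exists u => //; exists v.
by move=> [] [u Lu [v Cv <-]]; exists u; [left | exists v | right | exists v].
Qed.

Lemma lang_catUr : right_distributive lang_cat setU.
Proof.
move=> A B C; apply/seteqP; split=> w /=.
  by move=> [u Au [v [Bv | Cv] <-]]; [left | right]; exists u => //; exists v.
by move=> [] [u Au [v Lv <-]]; exists u => //; exists v => //; [left | right].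
Qed.

Lemma left_idealU A B : left_ideal A -> left_ideal B -> left_ideal (A `|` B).
Proof. by move=> lA lB u v [/lA Av | /lB Bv]; [left | right]. Qed.

Lemma right_idealU A B :
  right_ideal A -> right_ideal B -> right_ideal (A `|` B).
Proof. by move=> rA rB u v [/rA Au | /rB Bu]; [left | right]. Qed.

Lemma left_ideal_cat A B : left_ideal A -> left_ideal (lang_cat A B).
Proof.
move=> lA w _ [u Au [v Bv <-]]; rewrite catA.
by exists (w ++ u); [exact: lA | exists v].
Qed.

Lemma right_ideal_cat A B : right_ideal B -> right_ideal (lang_cat A B).
Proof.
move=> rB _ w [u Au [v Bv <-]]; rewrite -catA.
by exists u => //; exists (v ++ w) => //; exact: rB.
Qed.

Lemma lang_cat_nonempty A B :
  A !=set0 -> B !=set0 -> lang_cat A B !=set0.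
Proof. by move=> [u Au] [v Bv]; exists (u ++ v), u => //; exists v. Qed.

Lemma lang_catTx A : left_ideal A -> lang_cat setT A = A.
Proof.
move=> A_left; apply/seteqP; split=> [_ [u _ [v Av <-]] | w Aw].
  exact: A_left.
by exists nil => //; exists w.
Qed.

Lemma lang_catxT A : right_ideal A -> lang_cat A setT = A.
Proof.
move=> A_right; apply/seteqP; split=> [_ [u Au [v _ <-]] | w Aw].
  exact: A_right.
by exists w => //; exists nil; rewrite ?cats0.
Qed.

Lemma lang_cat_cancelr A B C : right_ideal B -> C !=set0 ->
  lang_cat A C `<=` lang_cat B C -> A `<=` B.
Proof.
move=> B_right /(exists_argmin size)[c Cc min_c] AC_BC w Aw.
have [|b Bb [c' Cc' bc'_wc]] := AC_BC (w ++ c).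
  by exists w => //; exists c.
have le_bw : size b <= size w.
  by rewrite -(leq_add2r (size c)) -[leqRHS]size_cat -bc'_wc size_cat
    leq_add2l min_c.
by have [s ->] := eq_cat_prefix (esym bc'_wc) le_bw; exact: B_right.
Qed.

Lemma lang_cat_cancell A B C : left_ideal B -> C !=set0 ->
  lang_cat C A `<=` lang_cat C B -> A `<=` B.
Proof.
move=> B_left /(exists_argmin size)[c Cc min_c] CA_CB w Aw.
have [|c' Cc' [b Bb c'b_cw]] := CA_CB (c ++ w).
  by exists c => //; exists w.
have [s ->] := eq_cat_suffix (esym c'b_cw) (min_c c' Cc').
exact: B_left.
Qed.

Record word_ideal := WordIdeal {
  ideal_words :> set (seq T);
  ideal_left : left_ideal ideal_words;
  ideal_right : right_ideal ideal_words;
  ideal_nonempty : ideal_words !=set0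
}.
Implicit Types I J K : word_ideal.

Lemma word_ideal_inj I J : ideal_words I = ideal_words J -> I = J.
Proof.
case: I J => [A Al Ar A0] [B Bl Br B0] /= AB; case: _ / AB in Bl Br B0 *.
by congr WordIdeal; exact: Prop_irrelevance.
Qed.

Definition ideal_all : word_ideal :=
  @WordIdeal setT (fun _ _ => id) (fun _ _ => id) (ex_intro _ nil Logic.I).

Definition ideal_union I J : word_ideal :=
  WordIdeal (left_idealU (@ideal_left I) (@ideal_left J))
    (right_idealU (@ideal_right I) (@ideal_right J))
    (subset_nonempty (@subsetUl _ I J) (ideal_nonempty I)).

Definition ideal_cat I J : word_ideal :=
  WordIdeal (left_ideal_cat (B := J) (@ideal_left I))
    (right_ideal_cat (A := I) (@ideal_right J))
    (lang_cat_nonempty (ideal_nonempty I) (ideal_nonempty J)).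

Lemma ideal_unionA : associative ideal_union.
Proof. by move=> I J K; apply: word_ideal_inj; exact: setUA. Qed.

Lemma ideal_unionC : commutative ideal_union.
Proof. by move=> I J; apply: word_ideal_inj; exact: setUC. Qed.

Lemma ideal_unionxx : idempotent_op ideal_union.
Proof. by move=> I; apply: word_ideal_inj; exact: setUid. Qed.

Lemma ideal_catA : associative ideal_cat.
Proof. by move=> I J K; apply: word_ideal_inj; exact: lang_catA. Qed.

Lemma ideal_catTx : left_id ideal_all ideal_cat.
Proof.
by move=> I; apply: word_ideal_inj; apply: lang_catTx; exact: ideal_left.
Qed.

Lemma ideal_catxT : right_id ideal_all ideal_cat.
Proof.
by move=> I; apply: word_ideal_inj; apply: lang_catxT; exact: ideal_right.
Qed.

Lemma ideal_catUl : left_distributive ideal_cat ideal_union.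
Proof. by move=> I J K; apply: word_ideal_inj; exact: lang_catUl. Qed.

Lemma ideal_catUr : right_distributive ideal_cat ideal_union.
Proof. by move=> I J K; apply: word_ideal_inj; exact: lang_catUr. Qed.

Definition ideal_slmonoid : slmonoid :=
  SLMonoid ideal_unionA ideal_unionC ideal_unionxx ideal_catA
    ideal_catTx ideal_catxT ideal_catUl ideal_catUr.

Lemma ideal_leE (I J : ideal_slmonoid) :
  I ≤ J <-> ideal_words I `<=` ideal_words J.
Proof.
rewrite -setUidPr; split=> [IJ | IJ]; last exact: word_ideal_inj.
by rewrite -[in RHS]IJ.
Qed.

Lemma ideal_slmonoid_integral : integral ideal_slmonoid.
Proof. by move=> I; apply/ideal_leE. Qed.

Lemma ideal_slmonoid_cancellative : cancellative ideal_slmonoid.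
Proof.
split=> I J K /ideal_leE sub; apply/ideal_leE.
  exact: lang_cat_cancelr (@ideal_right J) (ideal_nonempty K) sub.
exact: lang_cat_cancell (@ideal_left J) (ideal_nonempty K) sub.
Qed.

End Words.

Section DistributiveJoin.
Variable N : slmonoid.
Implicit Types (P Q : set N) (n m p q x y z : N).

Definition is_dist_join P n :=
  forall x y z, x ⋅ n ⋅ y ≤ z <-> forall p, P p -> x ⋅ p ⋅ y ≤ z.

Lemma dist_join_leE P n z :
  is_dist_join P n -> n ≤ z <-> forall p, P p -> p ≤ z.
Proof.
move=> /(_ slm_one slm_one z); rewrite slm_mul1x slm_mulx1 => ->.
by split=> le_z p /le_z; rewrite slm_mul1x slm_mulx1.
Qed.

Lemma dist_join_uniq P n m : is_dist_join P n -> is_dist_join P m -> n = m.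
Proof.
move=> Pn Pm; apply: slm_le_anti.
  by apply/(dist_join_leE _ Pn)/(dist_join_leE _ Pm); exact: slm_lexx.
by apply/(dist_join_leE _ Pm)/(dist_join_leE _ Pn); exact: slm_lexx.
Qed.

Lemma dist_join_max P n : P n -> (forall p, P p -> p ≤ n) -> is_dist_join P n.
Proof.
move=> Pn ub x y z; split=> [le_z p /ub le_pn | /(_ n Pn)//].
by apply: slm_le_trans le_z; do 2?apply: slm_leM => //; exact: slm_lexx.
Qed.

Lemma dist_joinU P Q n m :
  is_dist_join P n -> is_dist_join Q m -> is_dist_join (P `|` Q) (n ∨ m).
Proof.
move=> Pn Qm x y z; rewrite slm_mulUr slm_mulUl.
split=> [le_z p [Pp | Qp] | le_z].
- by apply: (Pn x y z).1 Pp; exact: slm_le_trans (slm_leUl _ _) le_z.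
- by apply: (Qm x y z).1 Qp; exact: slm_le_trans (slm_leUr _ _) le_z.
- by apply: slm_leU; [apply/Pn | apply/Qm] => p Lp; apply: le_z; [left | right].
Qed.

Lemma dist_joinM P Q n m : is_dist_join P n -> is_dist_join Q m ->
  is_dist_join [set p ⋅ q | p in P & q in Q] (n ⋅ m).
Proof.
move=> Pn Qm x y z.
have regroup p q : x ⋅ (p ⋅ q) ⋅ y = x ⋅ p ⋅ (q ⋅ y) by rewrite !slm_mulA.
split=> [|le_z].
  rewrite regroup => /Pn le_z _ [p Pp [q Qq <-]].
  rewrite slm_mulA; move: q Qq; apply/Qm.
  by rewrite -slm_mulA; exact: le_z.
rewrite regroup; apply/Pn => p Pp; rewrite slm_mulA; apply/Qm => q Qq.
by rewrite -(slm_mulA x); apply: le_z; exists p => //; exists q.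
Qed.

End DistributiveJoin.

Section WordProducts.
Variable N : slmonoid.
Hypothesis N_integral : integral N.
Implicit Types (n : N) (u v w : seq N) (A B : set (seq N)).

Definition word_prod w : N := foldr slm_mul slm_one w.

Lemma word_prod_cat u v : word_prod (u ++ v) = word_prod u ⋅ word_prod v.
Proof. by elim: u => /= [|n u ->]; rewrite ?slm_mul1x ?slm_mulA. Qed.

Lemma word_prod_lang_cat A B :
  word_prod @` lang_cat A B =
    [set p ⋅ q | p in word_prod @` A & q in word_prod @` B].
Proof.
apply/seteqP; split=> x.
  move=> [_ [u Au [v Bv <-]] <-]; exists (word_prod u); first by exists u.
  by exists (word_prod v); [exists v | rewrite word_prod_cat].
move=> [_ [u Au <-] [_ [v Bv <-] <-]].
by exists (u ++ v); [exists u => //; exists v | rewrite word_prod_cat].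
Qed.

Definition joinable (I : ideal_slmonoid N) :=
  exists n, is_dist_join (word_prod @` ideal_words I) n.

Lemma joinableU (I J : ideal_slmonoid N) :
  joinable I -> joinable J -> joinable (I ∨ J).
Proof.
move=> [n In] [m Jm]; exists (n ∨ m).
by rewrite /= image_setU; exact: dist_joinU.
Qed.

Lemma joinableM (I J : ideal_slmonoid N) :
  joinable I -> joinable J -> joinable (I ⋅ J).
Proof.
move=> [n In] [m Jm]; exists (n ⋅ m).
by rewrite /= word_prod_lang_cat; exact: dist_joinM.
Qed.

Lemma dist_join_all_words : is_dist_join (word_prod @` setT) slm_one.
Proof. by apply: dist_join_max => [|p _]; [exists nil | exact: N_integral]. Qed.

Lemma joinable1 : joinable slm_one.
Proof. exists slm_one; exact: dist_join_all_words. Qed.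

Definition joinable_ideals : slmonoid :=
  sub_slmonoid joinableU joinableM joinable1.
Implicit Types I J : joinable_ideals.

Definition ideal_sup I : N := sval (cid (svalP I)).

Lemma ideal_supP I :
  is_dist_join (word_prod @` ideal_words (sval I)) (ideal_sup I).
Proof. exact: svalP (cid (svalP I)). Qed.

Lemma ideal_supM : {morph ideal_sup : I J / I ⋅ J}.
Proof.
move=> I J; apply: dist_join_uniq (ideal_supP _) _.
rewrite /= word_prod_lang_cat; exact: dist_joinM (ideal_supP I) (ideal_supP J).
Qed.

Lemma ideal_sup1 : ideal_sup slm_one = slm_one.
Proof. exact: dist_join_uniq (ideal_supP slm_one) dist_join_all_words. Qed.

Definition words_below n : set (seq N) := [set w | word_prod w ≤ n].

Lemma left_ideal_below n : left_ideal (words_below n).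
Proof.
move=> u v le_vn; rewrite /words_below /= word_prod_cat -(slm_mul1x n).
exact: slm_leM (N_integral _) le_vn.
Qed.

Lemma right_ideal_below n : right_ideal (words_below n).
Proof.
move=> u v le_un; rewrite /words_below /= word_prod_cat -(slm_mulx1 n).
exact: slm_leM le_un (N_integral _).
Qed.

Lemma word_prod_letter n : word_prod [:: n] = n.
Proof. exact: slm_mulx1. Qed.

Lemma letter_below n : words_below n [:: n].
Proof. by rewrite /words_below /mkset word_prod_letter; exact: slm_lexx. Qed.

Definition below_ideal n : word_ideal N :=
  WordIdeal (@left_ideal_below n) (@right_ideal_below n)
    (ex_intro _ [:: n] (letter_below n)).

Lemma dist_join_below n : is_dist_join (word_prod @` words_below n) n.
Proof.
apply: dist_join_max => [|_ [w le_wn <-] //].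
by exists [:: n]; [exact: letter_below | exact: word_prod_letter].
Qed.

Definition below n : joinable_ideals :=
  exist joinable (below_ideal n) (ex_intro _ n (dist_join_below n)).

Lemma belowK : cancel below ideal_sup.
Proof.
move=> n; exact: dist_join_uniq (ideal_supP (below n)) (dist_join_below n).
Qed.

Lemma ideal_sup_adjoint I n : ideal_sup I ≤ n <-> I ≤ below n.
Proof.
rewrite (dist_join_leE _ (ideal_supP I)) sub_leE ideal_leE.
by split=> [le_n w Iw | le_n _ [w /le_n le_wn <-] //]; apply: le_n; exists w.
Qed.

End WordProducts.

Theorem theoremD (N : slmonoid) :
  integral N <->
  exists (M : slmonoid) (g : nucleus M),
    integral M /\ cancellative M /\ slm_isomorphic N (nuclear_image g).
Proof.
split=> [N_integral | [M] [g] [M_integral [_ iso]]].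
  exists (joinable_ideals N_integral).
  exists (adjoint_nucleus (@ideal_supM N N_integral)
            (@ideal_sup_adjoint N N_integral) (belowK N_integral)).
  split; first exact/sub_integral/ideal_slmonoid_integral.
  split; first exact/sub_cancellative/ideal_slmonoid_cancellative.
  exact/adjoint_nuclear_image/ideal_sup1.
exact: integral_isomorphic iso (nuclear_image_integral M_integral).
Qed.
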